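(* Let $F(\mathbf{x})=\prod_{c\in\mathcal{C}}\phi_c(\mathbf{x}_c)$ be the joint CDF of real-valued ordinal random variables $\mathbf{X}=\{X_1,\dots,X_K\}$ (continuous or discrete) represented by a cumulative distribution network whose graph is a tree with root variable node $X_r$, all variables being observed, and let $P(\mathbf{x})=\partial_{\mathbf{x}}[F(\mathbf{x})]$ be the joint PDF (probability density, or probability mass function in the discrete case). Let $\mu$ and $\lambda$ be the messages of the derivative-sum-product algorithm described in the context, passed from the leaves to the root. Then the joint PDF is given at the root node by $$P(\mathbf{x})=\lambda_{X_r\to\emptyset}(x_r).$$
   Context: Notation. For a set of variables $\mathbf{X}_s$, $\partial_{\mathbf{x}_s}[\cdot]$ denotes differentiation with respect to all the variables in $\mathbf{X}_s$ (or, for discrete variables, the finite difference operator with respect to them); $\partial_{\mathbf{x}_s,x_k}$ denotes the same operation with respect to $\mathbf{X}_s$ together with $X_k$. Derivatives with respect to observed variables are evaluated at the observed values. Cumulative distribution network (CDN): an undirected bipartite graph with variable nodes $X_1,\dots,X_K$ and function nodes $c\in\mathcal{C}$, where $c$ carries a function $\phi_c(\mathbf{x}_c)$ of a subset $\mathbf{X}_c\subseteq\mathbf{X}$ and is joined to the variables in $\mathbf{X}_c$. The joint CDF is $F(\mathbf{x})=\Pr\{X_1\le x_1,\dots,X_K\le x_K\}=\prod_{c\in\mathcal{C}}\phi_c(\mathbf{x}_c)$. Write $\mathrm{N}(X_k)=\{c\in\mathcal{C}: X_k\in\mathbf{X}_c\}$ and $\mathrm{N}(\phi_c)=\mathbf{X}_c$.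 Assumptions on the functions. The joint PDF $P$ exists. Each $\phi_c\ge 0$ and $\sup_{\mathbf{x}_c}\phi_c(\mathbf{x}_c)=1$; for every $X_i$ there is $c\in\mathrm{N}(X_i)$ with $\inf_{x_i}\phi_c(\mathbf{x}_c)=0$; for every $X_i$ and every $\mathbf{x}$ with $F(\mathbf{x})>0$, $\sum_{c\in\mathrm{N}(X_i)}\partial_{x_i}[\phi_c(\mathbf{x}_c)]/\phi_c(\mathbf{x}_c)\ge 0$; and $\partial_{\mathbf{x}_s}[\phi_c(\mathbf{x}_c)]\ge 0$ for all $c$ and all $\mathbf{X}_s\subseteq\mathbf{X}_c$ (at points where $F$ is strictly positive). All $\phi_c$ are differentiable with respect to all of their arguments; for discrete variables differentiation is replaced by finite differences. The network consists of fully observed variables (unobserved variables having been marginalized out by deleting them and modifying their neighboring functions). Derivative-sum-product algorithm. Messages $\mu$ and $\lambda$ are passed between function nodes and variable nodes, with $\lambda_{\phi_c\to X_k}(x_k)=\partial_{x_k}[\mu_{\phi_c\to X_k}(x_k)]$ and $\lambda_{X_k\to\phi_c}(x_k)=\partial_{x_k}[\mu_{X_k\to\phi_c}(x_k)]$, as follows. (i) For each leaf variable node $X_l$ and all $c\in\mathrm{N}(X_l)$, propagate $\mu_{X_l\to\phi_c}(x_l)=\lambda_{X_l\to\phi_c}(x_l)=1$. Each leaf function node $\phi_l(x_l)$ sends $\mu_{\phi_l\to X_l}(x_l)=\phi_l(x_l)$ and $\lambda_{\phi_l\to X_l}(x_l)=\partial_{x_l}[\phi_l(x_l)]$. (ii)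 For each non-leaf variable $X_k$ and neighboring functions $c\in\mathrm{N}(X_k)$, $$\mu_{X_k\to\phi_c}(x_k)=\prod_{c'\in\mathrm{N}(X_k)\setminus c}\mu_{\phi_{c'}\to X_k}(x_k),$$ $$\lambda_{X_k\to\phi_c}(x_k)=\partial_{x_k}[\mu_{X_k\to\phi_c}(x_k)]=\mu_{X_k\to\phi_c}(x_k)\sum_{c'\in\mathrm{N}(X_k)\setminus c}\frac{\lambda_{\phi_{c'}\to X_k}(x_k)}{\mu_{\phi_{c'}\to X_k}(x_k)}.$$ (iii) For each non-leaf function $c$ and neighboring variables $X_k\in\mathrm{N}(\phi_c)$, $$\mu_{\phi_c\to X_k}(x_k)=\sum_{(\mathbf{X}_s,\mathbf{X}_t)}\partial_{\mathbf{x}_s}[\phi_c(\mathbf{x}_c)]\prod_{j: X_j\in\mathbf{X}_s}\mu_{X_j\to\phi_c}(x_j)\prod_{j: X_j\in\mathbf{X}_t}\lambda_{X_j\to\phi_c}(x_j),$$ $$\lambda_{\phi_c\to X_k}(x_k)=\partial_{x_k}[\mu_{\phi_c\to X_k}(x_k)]=\sum_{(\mathbf{X}_s,\mathbf{X}_t)}\partial_{\mathbf{x}_s,x_k}[\phi_c(\mathbf{x}_c)]\prod_{j: X_j\in\mathbf{X}_s}\mu_{X_j\to\phi_c}(x_j)\prod_{j: X_j\in\mathbf{X}_t}\lambda_{X_j\to\phi_c}(x_j),$$ where the sums run over all $(\mathbf{X}_s,\mathbf{X}_t)$ with $\mathbf{X}_s\cup\mathbf{X}_t=\mathbf{X}_c\setminus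 X_k$ and $\mathbf{X}_s\cap\mathbf{X}_t=\emptyset$. (To obtain conditionals, steps (ii) and (iii) are repeated from root to leaves and messages are fused at each variable node.) The root message $\lambda_{X_r\to\emptyset}(x_r)$ is the variable-to-function message of step (ii) at $X_r$ with no function excluded, i.e. with product and sum over all $c'\in\mathrm{N}(X_r)$.
   Formalization: Leaf variables send λ=0 (=∂[μ]) instead of 1. For discrete variables, step (ii) uses λ=∂[μ] and step (iii) evaluates ∂_{x_s}[φ_c] at the predecessors of the discrete variables in X_t. Where some μ in (ii) is 0, λ=∂[μ] replaces the quotient. *)

(* Defs.v *)
From HB Require Import structures.
From mathcomp Require Import all_boot all_order all_algebra.
From mathcomp Require Import all_classical all_reals all_analysis.

Set Implicit Arguments.
Unset Strict Implicit.
Unset Printing Implicit Defensive.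

Import Order.TTheory GRing.Theory Num.Theory.
Import numFieldNormedType.Exports.

Local Open Scope classical_set_scope.
Local Open Scope ring_scope.

(* [DiscreteVar prev]: [prev t < t] is a point such that the variable takes no
   value strictly between [prev t] and [t] (see [joint_cdf_of_cdn]), so that
   the increment of a CDF from [prev t] to [t] is the probability of [t].
   For an integer-valued variable one takes [prev t = t - 1] on integers. *)
Inductive vkind (R : Type) := ContinuousVar | DiscreteVar of (R -> R).
Arguments ContinuousVar {R}.

Definition is_continuous (R : Type) (v : vkind R) : bool :=
  if v is ContinuousVar then true else false.

Section Derivatives.
Context {R : realType} {K : nat}.
Variable kind : 'I_K -> vkind R.
Implicit Types (f : 'rV[R]_K -> R) (x : 'rV[R]_K).

Definition setcoord x (k : 'I_K) (t : R) : 'rV[R]_K :=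
  \row_j (if j == k then t else x 0 j).

Definition lower (k : 'I_K) (t : R) : R :=
  if kind k is DiscreteVar prev then prev t else t.

(* x with its discrete coordinates in A moved to their predecessors *)
Definition lower_in (A : {set 'I_K}) x : 'rV[R]_K :=
  \row_j (if j \in A then lower j (x 0 j) else x 0 j).

(* the operator \partial_{x_k}[.] *)
Definition pd f (k : 'I_K) : 'rV[R]_K -> R := fun x =>
  if kind k is ContinuousVar then 'D_(delta_mx 0 k) f x
  else f x - f (setcoord x k (lower k (x 0 k))).

(* [pd_seq f [:: k1; ..; kn]] applies the operator of kn first *)
Definition pd_seq f (s : seq 'I_K) : 'rV[R]_K -> R :=
  foldr (fun k g => pd g k) f s.

(* the operator \partial_{x_s}[.] *)
Definition pd_set f (A : {set 'I_K}) : 'rV[R]_K -> R := pd_seq f (enum A).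

(* The iterated derivatives with respect to distinct variables of A exist and
   do not depend on the order of differentiation: this is what the notation
   \partial_{x_s}, indexed by a set of variables s, presupposes. *)
Definition pd_regular f (A : {set 'I_K}) : Prop :=
  (forall (s : seq 'I_K) (k : 'I_K), uniq (k :: s) ->
     {subset k :: s <= A} -> is_continuous (kind k) ->
     forall x, derivable (pd_seq f s) x (delta_mx 0 k)) /\
  (forall s s' : seq 'I_K, uniq s -> {subset s <= A} -> perm_eq s s' ->
     pd_seq f s =1 pd_seq f s').

End Derivatives.

Section Graph.
Context {K : nat} {C : finType}.
Variable scope : C -> {set 'I_K}.

Definition factor_graph : rel ('I_K + C) := fun u v =>
  match u, v with
  | inl k, inr c | inr c, inl k => k \in scope c
  | _, _ => false
  end.

(* N(X_k); N(phi_c) is [scope c] *)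
Definition nbr (k : 'I_K) : {set C} := [set c | k \in scope c].

End Graph.

Definition is_tree (V : finType) (e : rel V) : Prop :=
  (forall u v, connect e u v) /\
  (forall p : seq V, uniq p -> (2 < size p)%N -> ~~ cycle e p).

(* in a tree rooted at r: v is the neighbor of u on the path from u to r *)
Definition rootward (V : finType) (e : rel V) (r u v : V) : bool :=
  e u v && connect (fun a b => [&& e a b, a != u & b != u]) v r.

Section Network.
Context {R : realType} {K : nat} {C : finType}.
Variables (kind : 'I_K -> vkind R) (scope : C -> {set 'I_K}).
Variable phi : C -> 'rV[R]_K -> R.

Definition cdn (x : 'rV[R]_K) : R := \prod_c phi c x.

(* Functions of x_c are functions of the whole vector x that only depend on
   the coordinates in [scope c]. *)
Record is_cdn : Prop := IsCDN {
  cdn_local : forall c (x y : 'rV[R]_K),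
    (forall k, k \in scope c -> x 0 k = y 0 k) -> phi c x = phi c y;
  cdn_ge0 : forall c x, 0 <= phi c x;
  cdn_sup : forall c, sup (range (phi c)) = 1;
  cdn_inf : forall i : 'I_K, exists2 c, c \in nbr scope i &
    forall x, inf (range (fun t => phi c (setcoord x i t))) = 0;
  cdn_sum_ge0 : forall (i : 'I_K) x, 0 < cdn x ->
    0 <= \sum_(c in nbr scope i) pd kind (phi c) i x / phi c x;
  cdn_pd_ge0 : forall c (s : {set 'I_K}) x, s \subset scope c ->
    0 < cdn x -> 0 <= pd_set kind (phi c) s x;
  cdn_regular : forall c, pd_regular kind (phi c) (scope c)
}.

Definition splits (c : C) (k : 'I_K) (st : {set 'I_K} * {set 'I_K}) : bool :=
  (st.1 :|: st.2 == scope c :\ k) && (st.1 :&: st.2 == finset.set0).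

(* A message to or from X_k is a function of x_k given the observed values of
   the other variables; it is represented as a function of the whole x. *)
Section Messages.
Variables muVF lamVF : 'I_K -> C -> 'rV[R]_K -> R.
Variables muFV lamFV : C -> 'I_K -> 'rV[R]_K -> R.

(* the messages that X_k builds from those of the functions in A *)
Definition var_mu (k : 'I_K) (A : {set C}) (x : 'rV[R]_K) : R :=
  \prod_(c in A) muFV c k x.

(* The product rule in quotient form is used whenever it is valid, that is for
   a continuous variable and nonzero denominators.  It fails for finite
   differences: there the message is d_{x_k}[mu] itself. *)
Definition var_lam (k : 'I_K) (A : {set C}) (x : 'rV[R]_K) : R :=
  if is_continuous (kind k) && [forall (c | c \in A), muFV c k x != 0]
  then var_mu k A x * \sum_(c in A) lamFV c k x / muFV c k x
  else pd kind (var_mu k A) k x.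

(* The finite difference satisfies
     d[f g](x) = d[f](x) g(x) + f(prev x) d[g](x),
   so that in the sums over (s, t) the function phi_c is evaluated at the
   predecessors of the discrete variables in t; [lower_in] leaves the
   continuous variables unchanged. *)
Record dsp_messages (r : 'I_K) : Prop := DspMessages {
  (* mu is the constant 1, so that lambda = d_{x_l}[mu] is 0; the value 1 that is
     sometimes prescribed for lambda contradicts this and gives a wrong result *)
  dsp_leaf_var : forall l c, #|nbr scope l| = 1%N ->
    rootward (factor_graph scope) (inl r) (inl l) (inr c) ->
    forall x, muVF l c x = 1 /\ lamVF l c x = 0;
  dsp_leaf_fun : forall c l, #|scope c| = 1%N ->
    rootward (factor_graph scope) (inl r) (inr c) (inl l) ->
    forall x, muFV c l x = phi c x /\ lamFV c l x = pd kind (phi c) l x;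
  dsp_var : forall k c, #|nbr scope k| <> 1%N ->
    rootward (factor_graph scope) (inl r) (inl k) (inr c) ->
    forall x, muVF k c x = var_mu k (nbr scope k :\ c) x /\
              lamVF k c x = var_lam k (nbr scope k :\ c) x;
  dsp_fun_mu : forall c k, #|scope c| <> 1%N ->
    rootward (factor_graph scope) (inl r) (inr c) (inl k) ->
    forall x, muFV c k x =
      \sum_(st : {set 'I_K} * {set 'I_K} | splits c k st)
        pd_set kind (phi c) st.1 (lower_in kind st.2 x) *
        \prod_(j in st.1) muVF j c x * \prod_(j in st.2) lamVF j c x;
  dsp_fun_lam : forall c k, #|scope c| <> 1%N ->
    rootward (factor_graph scope) (inl r) (inr c) (inl k) ->
    forall x, lamFV c k x =
      \sum_(st : {set 'I_K} * {set 'I_K} | splits c k st)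
        pd_set kind (phi c) (k |: st.1) (lower_in kind st.2 x) *
        \prod_(j in st.1) muVF j c x * \prod_(j in st.2) lamVF j c x
}.

(* lambda_{X_r -> emptyset}: no function is excluded *)
Definition root_lam (r : 'I_K) : 'rV[R]_K -> R := var_lam r (nbr scope r).

End Messages.
End Network.

Section RandomVariables.
Context {R : realType} {K : nat} {d : measure_display} {T : measurableType d}.
Variables (Pr : probability T R) (X : 'I_K -> {RV Pr >-> R}).
Variable kind : 'I_K -> vkind R.

Definition joint_cdf (x : 'rV[R]_K) : R :=
  fine (Pr [set w | forall k, X k w <= x 0 k]).

Definition joint_pdf : 'rV[R]_K -> R := pd_set kind joint_cdf [set: 'I_K]%SET.

Definition joint_cdf_of_cdn (C : finType) (phi : C -> 'rV[R]_K -> R) : Prop :=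
  (forall k prev, kind k = DiscreteVar prev -> forall t,
     prev t < t /\ Pr [set w | prev t < X k w < t] = 0%E) /\
  (forall x, joint_cdf x = cdn phi x).

End RandomVariables.

(* Main.v *)
Require Import Defs.
From HB Require Import structures.
From mathcomp Require Import all_boot all_order all_algebra.
From mathcomp Require Import all_classical all_reals all_analysis.
Import boot.fintype boot.finset.

(** Cutting the tree at an edge u - v leaves a component containing u.  For every
    edge directed towards the root, the message mu is the derivative of the product
    of the functions in the component of the sender, with respect to all variables
    of that component except the variable at an end of the edge, and lambda is the
    derivative of mu with respect to that variable.  At a variable node the
    functions of the branches share only this variable, so the derivative of
    the product is the product of the derivatives.  At a function node the
    derivatives with respect to the variables inside the branches factor in the same way,
    and the sum over (s, t) is the Leibniz formula for the remaining
    derivatives of phi_c times the product of the incoming mu.  The same Leibniz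
    formula shows that iterated derivatives of products exist and do not depend on
    the order of differentiation. *)

Set Implicit Arguments.
Unset Strict Implicit.
Unset Printing Implicit Defensive.

Import Order.TTheory GRing.Theory Num.Theory.
Import numFieldNormedType.Exports.

Local Open Scope ring_scope.

(** * Components of a tree *)

Section Tree.
Variables (V : finType) (e : rel V).
Hypothesis e_sym : symmetric e.
Hypothesis e_irr : irreflexive e.
Hypothesis e_acyclic : forall p : seq V, uniq p -> (2 < size p)%N -> ~~ cycle e p.

(** The relation used inside [rootward], named so that [rootward e r u v] is an edge together with a
    connection in [avoiding u]. *)
Definition avoiding (v : V) : rel V := fun a b => [&& e a b, a != v & b != v].

(** In a tree, deleting the vertex v instead of the edge between u and v leaves the same component
    of u. *)
Definition side (u v : V) : {set V} := [set w | connect (avoiding v) u w].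

Lemma path_avoiding v u p :
  path (avoiding v) u p -> path e u p /\ v \notin p.
Proof.
elim: p u => //= a p IH u /andP[/and3P[eua _ av] /IH [-> vp]].
by rewrite eua inE negb_or eq_sym av vp.
Qed.

Lemma avoiding_path v u p :
  path e u p -> v \notin u :: p -> path (avoiding v) u p.
Proof.
elim: p u => //= a p IH u /andP[eua pth].
rewrite inE negb_or => /andP[vu vap]; rewrite IH // andbT /avoiding eua.
by move: vap; rewrite inE negb_or ![v == _]eq_sym in vu *; rewrite vu => /andP[].
Qed.

Lemma avoiding_sym v : symmetric (avoiding v).
Proof. by move=> a b; rewrite /avoiding e_sym; congr (_ && _); rewrite andbC. Qed.

Lemma connect_avoiding_sym v a b :
  connect (avoiding v) a b = connect (avoiding v) b a.
Proof. by apply: sym_connect_sym; exact: avoiding_sym. Qed.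

Lemma edge_neq u v : e u v -> u != v.
Proof. by apply: contraTneq => ->; rewrite e_irr. Qed.

(** Otherwise a shortened path from w to w' off u would close up through u to a cycle with at least
    three vertices. *)
Lemma neighbors_separated u w w' :
  e u w -> e u w' -> connect (avoiding u) w w' -> w = w'.
Proof.
move=> uw uw' /connectP[p0 /shortenP[p pth up _] def_w'].
have [pe pu] := path_avoiding pth.
case: p pth up def_w' pe pu => [//|a p] pth up def_w' pe pu.
have := e_acyclic (p := [:: u, w, a & p]).
rewrite /= rcons_path -[last a p]/(last w (a :: p)) -def_w' uw (e_sym w') uw'.
move: pe up => /= /andP[-> ->] /andP[wap ->].
have -> : u \notin [:: w, a & p] by rewrite inE negb_or (edge_neq uw).
by rewrite wap => /(_ isT isT).
Qed.

Lemma side_refl u v : u \in side u v.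
Proof. by rewrite inE connect0. Qed.

Lemma side_excl u v : e u v -> v \notin side u v.
Proof.
move=> uv; rewrite inE; apply/negP => /connectP[p pth def_v].
have [_] := path_avoiding pth.
case: p pth def_v => [|a p] _ /= def_v; first by move: uv; rewrite def_v e_irr.
by rewrite def_v mem_last.
Qed.

Lemma side_closed u v a b : e u v -> a \in side u v -> e a b -> b != v -> b \in side u v.
Proof.
move=> uv au ab bv; have av : a != v by apply: contraTneq au => ->; exact: side_excl.
move: au; rewrite !inE => /connect_trans; apply; apply: connect1.
by rewrite /avoiding ab av bv.
Qed.

(** A path from w off u cannot meet v, since v and w are distinct neighbours of u; preceded by the
    edge from u to w it is a path from u off v. *)
Lemma side_sub u v w : e u v -> e u w -> w != v -> side w u \subset side u v.
Proof.
move=> uv uw wv; apply/subsetP => z; rewrite !inE => /connectP[p pth def_z].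
have vp : v \notin w :: p.
  rewrite inE negb_or eq_sym wv; apply/negP => vp.
  case/splitPr: vp pth def_z => p1 p2 pth _.
  move: wv; rewrite (neighbors_separated uw uv) ?eqxx //.
  apply/connectP; exists (rcons p1 v); last by rewrite last_rcons.
  by move: pth; rewrite -cat_rcons cat_path => /andP[].
have [pe _] := path_avoiding pth.
apply/connectP; exists (w :: p) => //; apply: avoiding_path; first by rewrite /= uw.
by rewrite inE negb_or eq_sym (edge_neq uv).
Qed.

(** Once repetitions are removed the path never returns to u, so what follows its first step stays
    in the component of the neighbour reached. The relation f is [avoiding v] inside a component and
    [e] at the root. *)
Lemma connect_side u (f : rel V) z : subrel f e -> connect f u z ->
  z = u \/ exists2 w, f u w & z \in side w u.
Proof.
move=> fe /connectP[p0 /shortenP[p pth up _] def_z].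
case: p pth up def_z => [|w p] /= pth up def_z; first by left.
right; case/andP: pth => fuw pth; exists w => //; rewrite inE.
apply/connectP; exists p => //; apply: avoiding_path; first exact: sub_path pth.
by case/andP: up.
Qed.

Lemma in_side u v z : e u v ->
  z \in side u v <-> z = u \/ exists2 w, e u w && (w != v) & z \in side w u.
Proof.
move=> uv; split.
  rewrite inE => /(connect_side _)[|->|[w /and3P[uw _ wv] zw]].
  - by move=> a b /and3P[].
  - by left.
  - by right; exists w; rewrite ?uw.
case=> [->|[w /andP[uw wv]]]; first exact: side_refl.
by apply/subsetP; exact: side_sub.
Qed.

Lemma side_disjoint u w w' z :
  e u w -> e u w' -> z \in side w u -> z \in side w' u -> w = w'.
Proof.
move=> uw uw'; rewrite !inE => wz; rewrite connect_avoiding_sym => zw'.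
by apply: (neighbors_separated uw uw'); exact: connect_trans zw'.
Qed.

(** This strict decrease is the measure for the induction over the messages. *)
Lemma side_proper u v w : e u v -> e u w -> w != v -> (#|side w u| < #|side u v|)%N.
Proof.
move=> uv uw wv; apply: proper_card; rewrite properE side_sub //=.
apply/subsetPn; exists u; first exact: side_refl.
by apply: side_excl; rewrite e_sym.
Qed.

Lemma rootward_root r w : e w r -> rootward e r w r.
Proof. by move=> wr; rewrite /rootward wr connect0. Qed.

Lemma rootward_edge r u v : rootward e r u v -> e u v.
Proof. by case/andP. Qed.

(** The root lies in the component of v off u, and that component is contained in the component of u
    off w. *)
Lemma rootward_child r u v w :
  rootward e r u v -> e u w -> w != v -> rootward e r w u.
Proof.
case/andP=> uv vr uw wv; rewrite /rootward e_sym uw /=.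
rewrite -/(avoiding _) in vr *.
have : r \in side v u by rewrite inE.
have vu : e v u by rewrite e_sym.
move=> rv; suff: side v u \subset side u w by move/subsetP/(_ _ rv); rewrite inE.
by apply: side_sub; rewrite // eq_sym.
Qed.

End Tree.

(** * The Leibniz formula *)

Section Calculus.
Context {R : realType} {K : nat}.
Variable kind : 'I_K -> vkind R.
Implicit Types (f g : 'rV[R]_K -> R) (x y : 'rV[R]_K) (k : 'I_K).
Implicit Types (s : seq 'I_K) (A B L S : {set 'I_K}).

Local Notation pd := (pd kind).
Local Notation pd_seq := (pd_seq kind).
Local Notation pd_set := (pd_set kind).
Local Notation lower_in := (lower_in kind).
Local Notation pd_regular := (pd_regular kind).

(** * Functions of part of the coordinates and their derivatives *)

Definition local_on f L :=
  forall x y, (forall k, k \in L -> x 0 k = y 0 k) -> f x = f y.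

(** Vacuous for a discrete variable, so that both kinds are handled by the same statements. *)
Definition pd_derivable f k :=
  is_continuous (kind k) -> forall x, derivable f x (delta_mx 0 k).

Lemma local_sub f L L' : L \subset L' -> local_on f L -> local_on f L'.
Proof. by move=> /subsetP LL' fL x y xy; apply: fL => k /LL' /xy. Qed.

Lemma local_setT f : local_on f [set: 'I_K]%SET.
Proof. by move=> x y xy; congr f; apply/rowP => k; apply: xy; rewrite in_setT. Qed.

Lemma local_prod (I : finType) (P : pred I) (F : I -> 'rV[R]_K -> R) L :
  (forall i, P i -> local_on (F i) L) -> local_on (fun x => \prod_(i | P i) F i x) L.
Proof. by move=> FL x y xy; apply: eq_bigr => i /FL; apply. Qed.

Lemma pd_ext f g k : f =1 g -> pd f k =1 pd g k.
Proof. by move=> fg; have -> : f = g by apply/funext. Qed.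

(** A directional derivative sees only the restriction to a line; h = 0 makes the base values
    agree. *)
Lemma derive_shift_eq f g x y (v : 'rV[R]_K) :
  (forall h : R, f (h *: v + x) = g (h *: v + y)) ->
  'D_v f x = 'D_v g y /\ derivable f x v = derivable g y v.
Proof.
move=> fg; rewrite /derive /derivable.
have -> // : (fun h : R => h^-1 *: ((f \o shift x) (h *: v) - f x)) =
             (fun h : R => h^-1 *: ((g \o shift y) (h *: v) - g y)).
apply/funext => h /=; rewrite fg; congr (_ *: (_ - _)).
by have := fg 0; rewrite !scale0r !add0r.
Qed.

Lemma local_pd f k L : local_on f L -> local_on (pd f k) L.
Proof.
move=> fL x y xy; rewrite /Defs.pd; case E: (kind k) => [|prev].
  by apply: (derive_shift_eq _).1 => h; apply: fL => j jL; rewrite !mxE xy.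
rewrite (fL x y xy); congr (_ - _); apply: fL => j jL; rewrite !mxE.
by case: eqP => [<-|_]; rewrite xy.
Qed.

Lemma local_pd_seq f s L : local_on f L -> local_on (pd_seq f s) L.
Proof. by move=> fL; elim: s => //= k s; exact: local_pd. Qed.

Lemma local_pd_set f A L : local_on f L -> local_on (pd_set f A) L.
Proof. exact: local_pd_seq. Qed.

Lemma local_shift f L k x (h : R) : local_on f L -> k \notin L ->
  f (h *: delta_mx 0 k + x) = f x.
Proof.
move=> fL kL; apply: fL => j jL; rewrite !mxE /=.
by case: eqP => [jk|_]; [rewrite -jk jL in kL|rewrite mulr0 add0r].
Qed.

Lemma pd0 f k L : local_on f L -> k \notin L -> pd f k = fun=> 0.
Proof.
move=> fL kL; apply/funext => x; rewrite /Defs.pd; case E: (kind k) => [|prev].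
  rewrite /derive (_ : (fun h => _) = cst 0) ?lim_cst //.
  by apply/funext => h /=; rewrite (local_shift _ _ fL kL) subrr scaler0.
apply/eqP; rewrite subr_eq0; apply/eqP; apply: fL => j jL; rewrite mxE.
by case: eqP => // jk; rewrite -jk jL in kL.
Qed.

Lemma pd_derivable_local f k L : local_on f L -> k \notin L -> pd_derivable f k.
Proof.
move=> fL kL _ x; rewrite /derivable (_ : (fun h => _) = cst 0); first exact: is_cvg_cst.
by apply/funext => h /=; rewrite (local_shift _ _ fL kL) subrr scaler0.
Qed.

Lemma local_cst (a : R) L : local_on (fun=> a) L.
Proof. by []. Qed.

Lemma pd_seq_cst0 s : pd_seq (fun=> 0) s = fun=> 0.
Proof. by elim: s => //= k s ->; apply: (pd0 (local_cst 0 (L := set0))); rewrite in_set0. Qed.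

Lemma pd_seq_cat f s s' : pd_seq f (s ++ s') = pd_seq (pd_seq f s') s.
Proof. exact: foldr_cat. Qed.

(** The derivatives applied before the one in k keep f independent of x_k, and those applied after
    it preserve 0. *)
Lemma pd_seq0 f s k L : local_on f L -> k \in s -> k \notin L -> pd_seq f s = fun=> 0.
Proof.
move=> fL ks kL; case/splitPr: ks => s1 s2.
rewrite pd_seq_cat /= (pd0 (local_pd_seq s2 fL) kL); exact: pd_seq_cst0.
Qed.

Lemma pd_set0 f A L : local_on f L -> ~~ (A \subset L) -> pd_set f A = fun=> 0.
Proof.
by move=> fL /subsetPn[k kA kL]; apply: (pd_seq0 fL _ kL); rewrite mem_enum.
Qed.

Lemma pd_set_empty f : pd_set f set0 = f.
Proof. by rewrite /Defs.pd_set enum_set0. Qed.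

Lemma pd_set1 f k : pd_set f [set k] = pd f k.
Proof. by rewrite /Defs.pd_set enum_set1. Qed.

(** * First derivatives of sums, products and constants *)

Lemma pd_derivable_mul f g k : pd_derivable f k -> pd_derivable g k ->
  pd_derivable (fun x => f x * g x) k.
Proof. by move=> df dg ck x; apply: derivableM; [apply: df|apply: dg]. Qed.

Lemma pd_derivable_add f g k : pd_derivable f k -> pd_derivable g k ->
  pd_derivable (fun x => f x + g x) k.
Proof. by move=> df dg ck x; apply: derivableD; [apply: df|apply: dg]. Qed.

Lemma pd_derivable_cst (a : R) k : pd_derivable (fun=> a) k.
Proof. by move=> _ x; exact: derivable_cst. Qed.

Lemma pd_derivable_sum (I : Type) (r : seq I) (P : pred I) (F : I -> 'rV[R]_K -> R) k :
  (forall i, P i -> pd_derivable (F i) k) ->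
  pd_derivable (fun x => \sum_(i <- r | P i) F i x) k.
Proof.
move=> dF; elim: r => [|i r IH].
  by rewrite (_ : (fun _ => _) = fun=> 0); [exact: pd_derivable_cst|apply/funext => x; rewrite big_nil].
case Pi : (P i); last by rewrite (_ : (fun _ => _) = fun x => \sum_(i <- r | P i) F i x) //;
  apply/funext => x; rewrite big_cons Pi.
rewrite (_ : (fun _ => _) = fun x => F i x + \sum_(i <- r | P i) F i x);
  last by apply/funext => x; rewrite big_cons Pi.
by apply: pd_derivable_add => //; exact: dF.
Qed.

Lemma pd_derivable_prod (I : Type) (r : seq I) (P : pred I) (F : I -> 'rV[R]_K -> R) k :
  (forall i, P i -> pd_derivable (F i) k) ->
  pd_derivable (fun x => \prod_(i <- r | P i) F i x) k.
Proof.
move=> dF; elim: r => [|i r IH].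
  by rewrite (_ : (fun _ => _) = fun=> 1); [exact: pd_derivable_cst|apply/funext => x; rewrite big_nil].
case Pi : (P i); last by rewrite (_ : (fun _ => _) = fun x => \prod_(i <- r | P i) F i x) //;
  apply/funext => x; rewrite big_cons Pi.
rewrite (_ : (fun _ => _) = fun x => F i x * \prod_(i <- r | P i) F i x);
  last by apply/funext => x; rewrite big_cons Pi.
by apply: pd_derivable_mul => //; exact: dF.
Qed.

Lemma pd_add f g k x : pd_derivable f k -> pd_derivable g k ->
  pd (fun x => f x + g x) k x = pd f k x + pd g k x.
Proof.
rewrite /pd_derivable /Defs.pd; case: (kind k) => /= [df dg|prev _ _].
  by rewrite -deriveD //; [apply: df|apply: dg].
by rewrite opprD addrACA.
Qed.

Lemma pd_cst (a : R) k : pd (fun=> a) k = fun=> 0.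
Proof. by apply: (pd0 (local_cst a (L := set0))); rewrite in_set0. Qed.

Lemma pd_sum (I : Type) (r : seq I) (P : pred I) (F : I -> 'rV[R]_K -> R) k x :
  (forall i, P i -> pd_derivable (F i) k) ->
  pd (fun x => \sum_(i <- r | P i) F i x) k x = \sum_(i <- r | P i) pd (F i) k x.
Proof.
move=> dF; elim: r => [|i r IH].
  rewrite big_nil (@pd_ext _ (fun=> 0)) ?pd_cst // => y; exact: big_nil.
rewrite big_cons -IH; case: ifP => Pi; last by apply: pd_ext => y; rewrite big_cons Pi.
rewrite -pd_add; [|exact: dF|exact: pd_derivable_sum].
by apply: pd_ext => y; rewrite big_cons Pi.
Qed.

(** * Predecessor shifts and the product rule *)

Lemma lower_in_id A x : (forall k, k \in A -> is_continuous (kind k)) ->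
  lower_in A x = x.
Proof.
move=> cA; apply/rowP => j; rewrite mxE /lower; case: ifP => // /cA.
by case: (kind j).
Qed.

Lemma lower_in_set1 k x prev : kind k = DiscreteVar prev ->
  lower_in [set k] x = setcoord x k (lower kind k (x 0 k)).
Proof. by move=> dk; apply/rowP => j; rewrite !mxE in_set1; case: eqP => // ->. Qed.

(** One formula covers both kinds. For a continuous k the shift is the identity and this is the
    usual rule; for a discrete k the mixed product f(prev x) g(x) is subtracted and added. *)
Lemma pd_mul f g k x : pd_derivable f k -> pd_derivable g k ->
  pd (fun x => f x * g x) k x = pd f k x * g x + f (lower_in [set k] x) * pd g k x.
Proof.
rewrite /pd_derivable /Defs.pd; case E: (kind k) => [|prev] /= df dg.
  rewrite deriveM; [|exact: df|exact: dg].
  rewrite lower_in_id => [|j /set1P ->]; last by rewrite E.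
  by rewrite /GRing.scale /= addrC [g x * _]mulrC.
rewrite (lower_in_set1 x E); set y := setcoord _ _ _.
by rewrite mulrBl mulrBr addrA subrK.
Qed.

(** On a continuous coordinate k the shift is the identity, so it commutes with moving along that
    coordinate even if k is in A. *)
Lemma pd_derivable_lower f k A : pd_derivable f k ->
  pd_derivable (fun x => f (lower_in A x)) k.
Proof.
move=> df ck x; rewrite (derive_shift_eq (g := f) (y := lower_in A x) _).2; first exact: df.
move=> h; congr (f _); apply/rowP => j; rewrite !mxE /=.
rewrite /lower; case: eqP => [->|_]; last by rewrite mulr0 !add0r.
by move: ck; case: (kind k) => //; rewrite !if_same.
Qed.

Lemma pd_lower f k A x : k \notin A ->
  pd (fun x => f (lower_in A x)) k x = pd f k (lower_in A x).
Proof.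
move=> kA; rewrite /Defs.pd; case E: (kind k) => [|prev].
  apply: (derive_shift_eq _).1 => h; congr (f _); apply/rowP => j; rewrite !mxE /=.
  rewrite /lower; case: eqP => [->|_]; last by rewrite mulr0 !add0r.
  by rewrite (negPf kA).
congr (_ - f _); apply/rowP => j; rewrite !mxE (negPf kA).
by case: eqP => // ->; rewrite (negPf kA).
Qed.

(** The condition on k prevents the predecessor from being taken twice in one coordinate. *)
Lemma lower_in_setU1 k A x : k \notin A ->
  lower_in A (lower_in [set k] x) = lower_in (k |: A) x.
Proof.
move=> kA; apply/rowP => j; rewrite !mxE !inE.
by case: eqP => // ->; rewrite (negPf kA).
Qed.

(** * Regularity and the order of differentiation *)

Lemma regular_sub f S S' : S' \subset S -> pd_regular f S -> pd_regular f S'.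
Proof.
move=> /subsetP SS' [df ef]; split=> [s k us sS|s s' us sS]; first by apply: df => // j /sS /SS'.
by apply: ef => // j /sS /SS'.
Qed.

Lemma pd_set_perm f S s : pd_regular f S -> uniq s -> {subset s <= S} ->
  pd_seq f s = pd_set f [set k in s].
Proof.
move=> [_ ef] us sS; apply/funext; apply: ef => //.
apply: uniq_perm; rewrite ?enum_uniq // => k.
by rewrite mem_enum inE.
Qed.

(** The two enumerations in a row list the union without repetition, and regularity makes the order
    of the list irrelevant. *)
Lemma pd_setU f S A B : pd_regular f S -> A \subset S -> B \subset S ->
  [disjoint A & B] -> pd_set f (A :|: B) = pd_set (pd_set f B) A.
Proof.
move=> rf /subsetP AS /subsetP BS AB.
rewrite {2 3}/Defs.pd_set -pd_seq_cat (pd_set_perm rf).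
- by congr (pd_set f _); apply/setP => k; rewrite !inE mem_cat !mem_enum.
- rewrite cat_uniq !enum_uniq andbT /=; apply/hasPn => k; rewrite !mem_enum => kB.
  by apply/negP => kA; move/pred0P: AB => /(_ k) /=; rewrite kA kB.
- by move=> k; rewrite mem_cat !mem_enum => /orP[/AS|/BS].
Qed.

Lemma pd_setU1 f S A k : pd_regular f S -> k |: A \subset S -> k \notin A ->
  pd_set f (k |: A) = pd (pd_set f A) k.
Proof.
rewrite subUset => rf /andP[kS AS] kA; rewrite (pd_setU rf) ?pd_set1 //.
by rewrite disjoints1.
Qed.

Lemma pd_derivable_set f S A k : pd_regular f S -> k |: A \subset S -> k \notin A ->
  pd_derivable (pd_set f A) k.
Proof.
move=> [df _] kAS kA ck; apply: df => //=; first by rewrite mem_enum kA enum_uniq.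
by move=> j; rewrite inE mem_enum => jA; apply: (fintype.subsetP kAS); rewrite !inE.
Qed.

(** A derivative of [pd_set f A] along s is a derivative of f along [s ++ enum A], which has no
    repetition as long as s avoids A. *)
Lemma regular_pd_set f S A : pd_regular f S -> A \subset S ->
  pd_regular (pd_set f A) (S :\: A).
Proof.
move=> [df ef] /subsetP AS.
have sub s : uniq s -> {subset s <= S :\: A} ->
    uniq (s ++ enum A) /\ {subset s ++ enum A <= S}.
  move=> us sS; split.
    rewrite cat_uniq us enum_uniq andbT /=; apply/hasPn => k; rewrite mem_enum => kA.
    by apply/negP => /sS; rewrite !inE kA.
  by move=> k; rewrite mem_cat mem_enum => /orP[/sS|/AS //]; rewrite inE => /andP[].
split=> [s k us sS ck x|s s' us sS ss' x].
  rewrite -pd_seq_cat; have [us' sS'] := sub _ us sS.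
  exact: (df (s ++ enum A)).
rewrite -!pd_seq_cat; have [us' sS'] := sub _ us sS.
by apply: ef; rewrite // perm_cat2r.
Qed.

(** Any derivative involving a variable outside L vanishes identically. This lets factors with
    different scopes be regular on a common set of variables. *)
Lemma regular_local f L S : local_on f L -> pd_regular f L -> pd_regular f S.
Proof.
move=> fL [df ef]; split=> [s k us sS ck x|s s' us sS ss' x].
  have [kL|kL] := boolP (k \in L); last exact: (pd_derivable_local (local_pd_seq s fL) kL).
  have [/allP sL'|/allPn[j js jL]] := boolP (all (mem L) s).
    by apply: df => // j; rewrite inE => /orP[/eqP ->|/sL'].
  by rewrite (pd_seq0 fL js jL); exact: derivable_cst.
have [/allP sL'|/allPn[j js jL]] := boolP (all (mem L) s); first exact: ef.
by rewrite (pd_seq0 fL js jL) (pd_seq0 (k := j) fL) // -(perm_mem ss').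
Qed.

Lemma regular_cst (a : R) S : pd_regular (fun=> a) S.
Proof.
apply: (@regular_local (fun=> a) set0 S) => //; split=> [s k _ /(_ k)|[|k s] s' _ ss].
- by rewrite mem_head inE => /(_ isT).
- by rewrite perm_sym => /perm_nilP ->.
- by have := ss k (mem_head _ _); rewrite inE.
Qed.

(* The shift in the first factor comes from the product rule for finite
   differences, d(f g)(x) = d f(x) g(x) + f(prev x) d g(x). *)
Definition leibniz f g A x :=
  \sum_(t : {set 'I_K} | t \subset A)
    pd_set f (A :\: t) (lower_in t x) * pd_set g t x.

Lemma setD1_id A k : k \notin A -> A :\ k = A.
Proof. by move=> kA; apply/setDidPl; rewrite disjoint_sym disjoints1. Qed.

(** The subsets of [k |: A] come in pairs t and [k |: t], with t inside A. *)
Lemma sum_subset_setU1 (G : {set 'I_K} -> R) A k : k \notin A ->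
  \sum_(t : {set 'I_K} | t \subset k |: A) G t =
  \sum_(t : {set 'I_K} | t \subset A) (G t + G (k |: t)).
Proof.
move=> kA; rewrite (bigID (fun t : {set 'I_K} => k \in t)) /= addrC big_split /=.
congr (_ + _).
  apply: eq_bigl => t; rewrite andbC; have [kt|kt] /= := boolP (k \in t).
    by apply/esym/negbTE; apply: contra kA => /fintype.subsetP; apply.
  by rewrite -subDset setD1_id.
rewrite (reindex_onto (fun t => k |: t) (fun t => t :\ k)) => [|t /andP[_ kt]]; last exact: setD1K.
apply: eq_bigl => t; rewrite -subDset setU11 andbT setDUl setDv set0U.
have [kt|kt] := boolP (k \in t); last first.
  by rewrite setD1_id // eqxx andbT.
(* For t containing k both conditions fail: t is not inside A, and adding then removing k does not
   give t back. *)
have -> : t \subset A = false by apply/negbTE; apply: contra kA => /fintype.subsetP; apply.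
by apply/negbTE/nandP; right; apply: contraTneq kt => <-; rewrite !inE eqxx.
Qed.

Lemma pd_derivable_leibniz_term f g S A k (t : {set 'I_K}) : pd_regular f S -> pd_regular g S ->
  k |: A \subset S -> k \notin A -> t \subset A ->
  pd_derivable (fun x => pd_set f (A :\: t) (lower_in t x)) k /\
  pd_derivable (pd_set g t) k.
Proof.
move=> rf rg; rewrite subUset => /andP[kS AS] kA tA; split.
  apply: pd_derivable_lower; apply: (pd_derivable_set rf); last by rewrite inE (negPf kA) andbF.
  by rewrite subUset kS (fintype.subset_trans (subsetDl _ _) AS).
apply: (pd_derivable_set rg); last by apply: contra kA => /(fintype.subsetP tA).
by rewrite subUset kS (fintype.subset_trans tA AS).
Qed.

Lemma pd_derivable_leibniz f g S A k : pd_regular f S -> pd_regular g S ->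
  k |: A \subset S -> k \notin A -> pd_derivable (leibniz f g A) k.
Proof.
move=> rf rg kAS kA; apply: pd_derivable_sum => t tA.
by have [? ?] := pd_derivable_leibniz_term rf rg kAS kA tA; exact: pd_derivable_mul.
Qed.

(** The product rule splits the term of t in two. If k falls on f this is the term of t for
    [k |: A]; if k falls on g it is the term of [k |: t], whose additional shift in k is the one of
    the product rule. *)
Lemma pd_leibniz f g S A k : pd_regular f S -> pd_regular g S ->
  k |: A \subset S -> k \notin A -> pd (leibniz f g A) k = leibniz f g (k |: A).
Proof.
move=> rf rg kAS kA; apply/funext => x; rewrite pd_sum; last first.
  by move=> t tA; have [? ?] := pd_derivable_leibniz_term rf rg kAS kA tA;
    exact: pd_derivable_mul.
rewrite /leibniz sum_subset_setU1 //; apply: eq_bigr => t tA.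
have [dF dG] := pd_derivable_leibniz_term rf rg kAS kA tA.
have kt : k \notin t by apply: contra kA => /(fintype.subsetP tA).
rewrite pd_mul // pd_lower // lower_in_setU1 //.
move: kAS; rewrite subUset => /andP[kS AS].
rewrite -(pd_setU1 rf) ?inE ?(negPf kA) ?andbF //; last first.
  by rewrite subUset kS (fintype.subset_trans (subsetDl _ _) AS).
rewrite -(pd_setU1 rg) //; last by rewrite subUset kS (fintype.subset_trans tA AS).
congr (pd_set f _ _ * _ + pd_set f _ _ * _); apply/setP => j; rewrite !inE.
  by case: eqP => // ->; rewrite kt.
by case: eqP => //= ->; rewrite (negPf kA) andbF.
Qed.

Lemma leibniz0 f g : leibniz f g set0 = fun x => f x * g x.
Proof.
apply/funext => x; rewrite /leibniz (big_pred1 set0) => [|t]; last by rewrite subset0.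
by rewrite setD0 !pd_set_empty lower_in_id // => k; rewrite inE.
Qed.

(** The list s may be in any order, while the result depends only on its set of elements;
    [regular_mul] gets order independence from this. *)
Lemma pd_seq_mul f g S s : pd_regular f S -> pd_regular g S ->
  uniq s -> {subset s <= S} ->
  pd_seq (fun x => f x * g x) s = leibniz f g [set k in s].
Proof.
move=> rf rg; elim: s => [_ _|k s IH /= /andP[ks us] sS].
  by rewrite set_nil leibniz0.
rewrite IH // => [|j js]; last by rewrite sS // inE js orbT.
rewrite (pd_leibniz rf rg) ?inE ?set_cons //.
by apply/fintype.subsetP => j; rewrite !inE => jks; apply: sS; rewrite inE.
Qed.

Lemma regular_mul f g S : pd_regular f S -> pd_regular g S ->
  pd_regular (fun x => f x * g x) S.
Proof.
move=> rf rg; split=> [s k /andP[ks us] sS ck x|s s' us sS ss' x].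
  rewrite (pd_seq_mul rf rg) // => [|j js]; last by rewrite sS // inE js orbT.
  apply: (pd_derivable_leibniz rf rg); rewrite ?inE //.
  by apply/fintype.subsetP => j; rewrite !inE => jks; apply: sS; rewrite inE.
rewrite !(pd_seq_mul rf rg) //.
- by congr leibniz; apply/setP => k; rewrite !inE (perm_mem ss').
- by rewrite -(perm_uniq ss').
- by move=> k; rewrite -(perm_mem ss'); exact: sS.
Qed.

Lemma regular_prod (I : Type) (r : seq I) (P : pred I) (F : I -> 'rV[R]_K -> R) S :
  (forall i, P i -> pd_regular (F i) S) ->
  pd_regular (fun x => \prod_(i <- r | P i) F i x) S.
Proof.
move=> rF; elim: r => [|i r IH].
  rewrite (_ : (fun _ => _) = fun=> 1); first exact: regular_cst.
  by apply/funext => x; rewrite big_nil.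
case Pi : (P i); last by rewrite (_ : (fun _ => _) = fun x => \prod_(i <- r | P i) F i x) //;
  apply/funext => x; rewrite big_cons Pi.
rewrite (_ : (fun _ => _) = fun x => F i x * \prod_(i <- r | P i) F i x);
  last by apply/funext => x; rewrite big_cons Pi.
by apply: regular_mul => //; exact: rF.
Qed.

Lemma pd_set_mul f g S A : pd_regular f S -> pd_regular g S -> A \subset S ->
  pd_set (fun x => f x * g x) A = leibniz f g A.
Proof.
move=> rf rg /fintype.subsetP AS; rewrite /Defs.pd_set (pd_seq_mul rf rg) ?enum_uniq ?set_enum //.
by move=> k; rewrite mem_enum; exact: AS.
Qed.


(** * Products whose factors are differentiated in separate variables *)

Lemma pd_set_mul_separate f g S A B Lf Lg : pd_regular f S -> pd_regular g S ->
  A :|: B \subset S -> local_on f Lf -> local_on g Lg ->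
  [disjoint A & B] -> [disjoint B & Lf] -> [disjoint A & Lg] ->
  pd_set (fun x => f x * g x) (A :|: B) = fun x => pd_set f A x * pd_set g B x.
Proof.
move=> rf rg ABS fL gL AB BLf ALg; rewrite (pd_set_mul rf rg) //.
(* Only the term t = B remains; its shift moves coordinates in B, on which f does not depend. *)
apply/funext => x; rewrite /leibniz (bigD1 B) ?subsetUr //= big1 ?addr0.
  rewrite setDUl setDv setU0 (setDidPl _) //; congr (_ * _).
  apply: (local_pd_set _ fL) => k kL; rewrite mxE ifN //.
  by apply: contraTN kL => kB; rewrite (disjointFr BLf).
move=> t /andP[tAB tB].
(* For another t, either the derivative of g vanishes, or t lies inside B and leaves some variable
   of B to f, whose derivative then vanishes. *)
have [tL|tL] := boolP (t \subset Lg); last by rewrite (pd_set0 gL tL) mulr0.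
rewrite (pd_set0 fL (A := _ :\: t)) ?mul0r //.
have {tAB} tB' : t \subset B.
  apply/fintype.subsetP => k kt; have := fintype.subsetP tAB k kt.
  by rewrite !inE; case/orP => // /(disjointFr ALg); rewrite (fintype.subsetP tL).
have /subsetPn[k kB kt] : ~~ (B \subset t) by apply: contra tB => Bt; rewrite finset.eqEsubset tB'.
apply/subsetPn; exists k; first by rewrite !inE kt kB orbT.
by rewrite (disjointFr BLf).
Qed.

(** The factor i is differentiated in [A i] and depends on [L i]. Factors may share variables as
    long as nothing is differentiated in these. *)
Lemma pd_set_prod (I : finType) (r : seq I) (F : I -> 'rV[R]_K -> R)
    (A L : I -> {set 'I_K}) S : uniq r ->
  (forall i, i \in r -> [/\ pd_regular (F i) S, A i \subset S, A i \subset L i &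
     local_on (F i) (L i)]) ->
  {in r &, forall i j, i != j -> [disjoint A i & L j]} ->
  pd_set (fun x => \prod_(i <- r) F i x) (\bigcup_(i <- r) A i) =
  fun x => \prod_(i <- r) pd_set (F i) (A i) x.
Proof.
elim: r => [|i r IH] ur FA dA.
  apply/funext => x; rewrite !big_nil pd_set_empty.
  by rewrite big_nil.
have rF : forall j, j \in r -> pd_regular (F j) S.
  by move=> j jr; have [] := FA j; rewrite // inE jr orbT.
have [rFi AiS AiL FiL] := FA i (mem_head _ _).
have rest j : j \in r -> [/\ A j \subset S, A j \subset L j, local_on (F j) (L j),
    [disjoint A i & L j] & [disjoint A j & L i]].
  move=> jr; have ij : i != j by apply: contraTneq jr => <-; case/andP: ur.
  have jir : j \in i :: r by rewrite inE jr orbT.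
  have [_ AS AL FL] := FA j jir.
  by split=> //; apply: dA; rewrite // ?mem_head // eq_sym.
rewrite (_ : (fun x => _) = fun x => F i x * \prod_(j <- r) F j x); last first.
  by apply/funext => x; rewrite big_cons.
rewrite big_cons (@pd_set_mul_separate _ _ S _ _ (L i) (\bigcup_(j <- r) L j)) //.
- apply/funext => x; rewrite big_cons IH //; first by case/andP: ur.
    by move=> j jr; apply: FA; rewrite inE jr orbT.
  by move=> j k jr kr; apply: dA; rewrite inE ?jr ?kr orbT.
(* Membership in r is made a condition of the product, because regularity is only known for those
   factors. *)
- rewrite (_ : (fun x => _) = fun x => \prod_(j <- r | j \in r) F j x).
    exact: regular_prod.
  by apply/funext => x; rewrite -big_seq.
- rewrite subUset AiS; rewrite bigcup_seq; apply/bigcupsP => j jr.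
  by have [] := rest j jr.
- move=> x y xy; rewrite big_seq [RHS]big_seq; apply: eq_bigr => j jr.
  have [_ _ FL _ _] := rest j jr; apply: FL => k kL; apply: xy.
  by rewrite bigcup_seq; apply/bigcupP; exists j.
- rewrite disjoint_sym disjoints_subset; rewrite bigcup_seq; apply/bigcupsP => j jr.
  rewrite -disjoints_subset disjoint_sym; have [_ AL _ dij _] := rest j jr.
  by rewrite disjoint_sym (disjointWl AL) // disjoint_sym.
- rewrite disjoints_subset; rewrite bigcup_seq; apply/bigcupsP => j jr.
  by rewrite -disjoints_subset; have [] := rest j jr.
- rewrite disjoint_sym disjoints_subset; rewrite bigcup_seq; apply/bigcupsP => j jr.
  by rewrite -disjoints_subset disjoint_sym; have [] := rest j jr.
Qed.

Lemma pd_set_bigcup (I : finType) (J : {set I}) (F : I -> 'rV[R]_K -> R)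
    (A L : I -> {set 'I_K}) S :
  (forall i, i \in J -> [/\ pd_regular (F i) S, A i \subset S, A i \subset L i &
     local_on (F i) (L i)]) ->
  {in J &, forall i j, i != j -> [disjoint A i & L j]} ->
  pd_set (fun x => \prod_(i in J) F i x) (\bigcup_(i in J) A i) =
  fun x => \prod_(i in J) pd_set (F i) (A i) x.
Proof.
move=> FA dA; rewrite -big_enum (_ : (fun x => _) = fun x => \prod_(i <- enum J) F i x); last first.
  by apply/funext => x; rewrite big_enum.
rewrite (@pd_set_prod _ _ _ _ L S) ?enum_uniq //.
- by apply/funext => x; rewrite big_enum.
- by move=> i; rewrite mem_enum; exact: FA.
- by move=> i j; rewrite !mem_enum; exact: dA.
Qed.

End Calculus.

(** * Correctness of the messages *)

(** Each j of the union lies in a single block, so after exchanging the products the inner one has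
    one factor. *)
Lemma prod_bigcup (R : comPzSemiRingType) (I J : finType) (A : {set I}) (B : I -> {set J})
    (F : J -> R) :
  {in A &, forall i i' j, j \in B i -> j \in B i' -> i = i'} ->
  \prod_(j in \bigcup_(i in A) B i) F j = \prod_(i in A) \prod_(j in B i) F j.
Proof.
move=> injB; rewrite (exchange_big_dep (fun j => j \in \bigcup_(i in A) B i)) /=; last first.
  by move=> i j iA jB; apply/bigcupP; exists i.
apply: eq_bigr => j /bigcupP[i iA jB].
rewrite (big_pred1 i) // => i' /=; apply/andP/eqP => [[i'A jB']|-> //].
exact: (injB _ _ i'A iA j).
Qed.

Section Messages.
Context {R : realType} {K : nat} {C : finType}.
Variables (kind : 'I_K -> vkind R) (scope : C -> {set 'I_K}).
Variables (phi : C -> 'rV[R]_K -> R) (r : 'I_K).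
Variables (muVF lamVF : 'I_K -> C -> 'rV[R]_K -> R).
Variables (muFV lamFV : C -> 'I_K -> 'rV[R]_K -> R).
Hypothesis phi_local : forall c, local_on (phi c) (scope c).
Hypothesis phi_regular : forall c, pd_regular kind (phi c) (scope c).
Hypothesis tree : is_tree (factor_graph scope).
Hypothesis messages : dsp_messages kind scope phi muVF lamVF muFV lamFV r.

Local Notation e := (factor_graph scope).
Local Notation pd := (pd kind).
Local Notation pd_set := (pd_set kind).
Local Notation lower_in := (lower_in kind).
Local Notation pd_regular := (pd_regular kind).

Lemma factor_graph_sym : symmetric e.
Proof. by move=> [k|c] [k'|c']. Qed.

Lemma factor_graph_irr : irreflexive e.
Proof. by move=> [k|c]. Qed.

Local Notation e_sym := factor_graph_sym.
Local Notation e_irr := factor_graph_irr.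
Local Notation e_acyclic := tree.2.

(** * Branches of the factor graph and their functions *)

Definition vars (u v : 'I_K + C) : {set 'I_K} := [set k | inl k \in side e u v].
Definition facs (u v : 'I_K + C) : {set C} := [set c | inr c \in side e u v].

Lemma in_vars u v k : (k \in vars u v) = (inl k \in side e u v).
Proof. exact: in_set. Qed.

Lemma in_facs u v c : (c \in facs u v) = (inr c \in side e u v).
Proof. exact: in_set. Qed.

Definition subtree_fun (u v : 'I_K + C) (x : 'rV[R]_K) : R :=
  \prod_(c in facs u v) phi c x.

Lemma regular_phi c S : pd_regular (phi c) S.
Proof. exact: (regular_local S (@phi_local c) (@phi_regular c)). Qed.

Lemma regular_subtree u v S : pd_regular (subtree_fun u v) S.
Proof. by apply: regular_prod => c _; exact: regular_phi. Qed.

(** A function in the component of c has its variables there too, except possibly k, the deleted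
    vertex. *)
Lemma local_subtree_FV c k : k \in scope c ->
  local_on (subtree_fun (inr c) (inl k)) (k |: vars (inr c) (inl k)).
Proof.
move=> kc; apply: local_prod => c' c's; apply: local_sub (@phi_local c').
apply/subsetP => j jc'; rewrite in_setU1 in_vars; have [//|jk] := eqVneq j k.
have ck : e (inr c) (inl k) by [].
by rewrite in_facs in c's; apply: (side_closed e_irr ck c's).
Qed.

(** Here the deleted vertex is a function node, so no variable has to be added. *)
Lemma local_subtree_VF k c : k \in scope c ->
  local_on (subtree_fun (inl k) (inr c)) (vars (inl k) (inr c)).
Proof.
move=> kc; apply: local_prod => c' c's; apply: local_sub (@phi_local c').
apply/subsetP => j jc'; rewrite in_vars.
have ck : e (inl k) (inr c) by [].
by rewrite in_facs in c's; apply: (side_closed e_irr ck c's).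
Qed.

Lemma vars_FV_excl c k : k \in scope c -> k \notin vars (inr c) (inl k).
Proof. by move=> kc; rewrite in_vars (side_excl (e := e) e_irr). Qed.

Lemma vars_FV_disjoint k c c' : k \in scope c -> k \in scope c' -> c != c' ->
  [disjoint vars (inr c) (inl k) & vars (inr c') (inl k)].
Proof.
move=> kc kc' cc'; apply/pred0P => j /=; apply/negbTE/negP; rewrite !in_vars => /andP[jc jc'].
have ck : e (inl k) (inr c) by [].
have ck' : e (inl k) (inr c') by [].
have [E] := side_disjoint e_sym e_irr e_acyclic ck ck' jc jc'.
by rewrite E eqxx in cc'.
Qed.

Lemma vars_VF_disjoint c j j' : j \in scope c -> j' \in scope c -> j != j' ->
  [disjoint vars (inl j) (inr c) & vars (inl j') (inr c)].
Proof.
move=> kc kc' cc'; apply/pred0P => i /=; apply/negbTE/negP; rewrite !in_vars => /andP[jc jc'].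
have ck : e (inr c) (inl j) by [].
have ck' : e (inr c) (inl j') by [].
have [E] := side_disjoint e_sym e_irr e_acyclic ck ck' jc jc'.
by rewrite E eqxx in cc'.
Qed.

(** The branches at k share only x_k, in which nothing is differentiated yet, so a single derivative
    of the whole product splits into the incoming messages. *)
Lemma var_mu_subtrees k (A : {set C}) : A \subset nbr scope k ->
  (forall c, c \in A -> muFV c k =
     pd_set (subtree_fun (inr c) (inl k)) (vars (inr c) (inl k))) ->
  var_mu muFV k A =
  pd_set (fun x => \prod_(c in \bigcup_(c in A) facs (inr c) (inl k)) phi c x)
    (\bigcup_(c in A) vars (inr c) (inl k)).
Proof.
move=> /subsetP AN muA; have kA c : c \in A -> k \in scope c by move/AN; rewrite inE.
rewrite (_ : (fun x => _) = fun x => \prod_(c in A) subtree_fun (inr c) (inl k) x); last first.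
  apply/funext => x; apply: prod_bigcup => c c' /kA kc /kA kc' c''.
  rewrite !in_facs => c''c c''c'.
  by have [] := side_disjoint e_sym e_irr e_acyclic (kc : e (inl k) (inr c)) (kc' : e (inl k) (inr c')) c''c c''c'.
rewrite (@pd_set_bigcup _ _ _ _ _ _ _ (fun c => k |: vars (inr c) (inl k)) [set: 'I_K]%SET).
- by apply/funext => x; apply: eq_bigr => c cA; rewrite muA.
- move=> c cA; split; rewrite ?subsetT ?subsetUr //; first exact: regular_subtree.
  by apply: local_subtree_FV; exact: kA.
- move=> c c' cA c'A cc'; rewrite disjoint_sym disjoints_subset subUset sub1set in_setC.
  by rewrite vars_FV_excl ?kA //= -disjoints_subset disjoint_sym vars_FV_disjoint ?kA.
Qed.

(** In the quotient case the formula is the product rule for a continuous variable, written with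
    logarithmic derivatives; in the other case it holds by definition. *)
Lemma var_lam_pd k (A : {set C}) : A \subset nbr scope k ->
  (forall c, c \in A -> pd_derivable kind (muFV c k) k /\ lamFV c k = pd (muFV c k) k) ->
  var_lam kind muFV lamFV k A = pd (var_mu muFV k A) k.
Proof.
move=> /subsetP AN HA; apply/funext => x; rewrite /var_lam; case: ifP => // /andP[ck /forall_inP nz].
rewrite /var_mu.
have prod_rule (s : seq C) : {subset s <= A} ->
    (\prod_(c <- s) muFV c k x) * (\sum_(c <- s) lamFV c k x / muFV c k x) =
    pd (fun y => \prod_(c <- s) muFV c k y) k x.
  elim: s => [|c s IH] sA.
    rewrite !big_nil mulr0 (_ : (fun y => _) = fun=> 1) ?pd_cst //.
    by apply/funext => y; rewrite big_nil.
  rewrite (_ : (fun y => _) = fun y => muFV c k y * \prod_(c <- s) muFV c k y); last first.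
    by apply/funext => y; rewrite big_cons.
  have cA := sA c (mem_head _ _).
  have sA' : {subset s <= A} by move=> j js; apply: sA; rewrite inE js orbT.
  have [dc lc] := HA c cA.
  rewrite pd_mul //; last first.
    rewrite (_ : (fun y => _) = fun y => \prod_(c <- s | c \in s) muFV c k y).
      by apply: pd_derivable_prod => j /sA' /HA[].
    by apply/funext => y; rewrite -big_seq.
  rewrite -IH // lower_in_id; last by move=> j /set1P ->.
  rewrite !big_cons -lc mulrDr; congr (_ + _); last by rewrite mulrA.
  (* In the new term the nonzero message cancels its own denominator. *)
  by rewrite mulrAC [muFV c k x * _]mulrC divfK ?nz.
rewrite -!big_enum prod_rule //; last by move=> c; rewrite mem_enum.
by congr (pd _ k x); apply/funext => y; rewrite -big_enum.
Qed.

(** A split is determined by its second set, the first being the complement within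
    [scope c :\ k]. *)
Lemma sum_splits c k (H : {set 'I_K} -> {set 'I_K} -> R) :
  \sum_(st | splits scope c k st) H st.1 st.2 =
  \sum_(t : {set 'I_K} | t \subset scope c :\ k) H ((scope c :\ k) :\: t) t.
Proof.
rewrite (reindex_onto (fun t : {set 'I_K} => ((scope c :\ k) :\: t, t)) (fun st => st.2)) /=; last first.
  case=> s t /= /andP[/eqP <- /eqP st]; congr (_, _).
  rewrite setDUl setDv setU0; apply/setDidPl.
  by rewrite -setI_eq0 st.
apply: eq_bigl => t; rewrite eqxx andbT /splits /=.
have -> : ((scope c :\ k) :\: t) :&: t = set0.
  by apply/setP => i; rewrite !inE; case: (i \in t); rewrite ?andbF.
rewrite eqxx andbT; apply/eqP/idP => [<-|tW]; first exact: subsetUr.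
by rewrite -[in RHS](setID (scope c :\ k) t) setUC (setIidPr tW).
Qed.

(** * The step at a function node *)

Section FactorStep.
Variables (c : C) (k : 'I_K).
Hypothesis kc : k \in scope c.
Let W : {set 'I_K} := scope c :\ k.
Hypothesis mu_children : forall j, j \in W ->
  muVF j c = pd_set (subtree_fun (inl j) (inr c)) (vars (inl j) (inr c) :\ j).
Hypothesis lam_children : forall j, j \in W -> lamVF j c = pd (muVF j c) j.

(** The variables strictly inside the branches, away from [scope c]; with [W] they make up the
    variables of the component of c. *)
Let U : {set 'I_K} := \bigcup_(j in W) (vars (inl j) (inr c) :\ j).
Let M (x : 'rV[R]_K) : R := \prod_(j in W) muVF j c x.

Let edge_ck : e (inr c) (inl k) := kc.

Let W_scope j : j \in W -> j \in scope c.
Proof. by rewrite in_setD1 => /andP[]. Qed.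

Let W_neq j : j \in W -> inl j != inl k :> 'I_K + C.
Proof. by rewrite in_setD1 => /andP[]. Qed.

Let self_var j : j \in vars (inl j) (inr c).
Proof. by rewrite in_vars side_refl. Qed.

(** A variable i of c starts its own branch at c; if i also lay in the branch of another j, two
    branches would meet. *)
Lemma vars_scope j i : j \in W -> i \in vars (inl j) (inr c) -> i \in scope c -> i = j.
Proof.
move=> jW; rewrite in_vars => ij ic.
have cj : e (inr c) (inl j) by exact: W_scope.
have ci : e (inr c) (inl i) by [].
by have [] := side_disjoint e_sym e_irr e_acyclic ci cj (side_refl _ _ _) ij.
Qed.

Lemma U_scope_disjoint : [disjoint U & scope c].
Proof.
rewrite disjoints_subset; apply/bigcupsP => j jW; apply/subsetP => i.
rewrite in_setD1 in_setC => /andP[ij iv]; apply: contra ij => ic.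
by rewrite (vars_scope jW iv ic).
Qed.

Lemma vars_FV_split : vars (inr c) (inl k) = W :|: U.
Proof.
apply/setP => i; rewrite in_vars in_setU; apply/idP/orP.
  case/(in_side e_sym e_irr e_acyclic _ edge_ck)=> [//|[[j|//] /andP[jc jk] ij]].
  have jW : j \in W by rewrite in_setD1 (jc : j \in scope c) andbT.
  have [->|nij] := eqVneq i j; first by left.
  by right; apply/bigcupP; exists j; rewrite // in_setD1 nij in_vars.
have sub j : j \in W -> i \in vars (inl j) (inr c) -> inl i \in side e (inr c) (inl k).
  move=> jW; rewrite in_vars => ij.
  apply/(in_side e_sym e_irr e_acyclic _ edge_ck); right; exists (inl j) => //.
  by rewrite W_neq // andbT; exact: W_scope.
case=> [iW|/bigcupP[j jW]]; first exact: (sub i).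
by rewrite in_setD1 => /andP[_]; exact: sub.
Qed.

Lemma facs_FV_split :
  facs (inr c) (inl k) = c |: \bigcup_(j in W) facs (inl j) (inr c).
Proof.
apply/setP => i; rewrite in_facs in_setU1; apply/idP/orP.
  case/(in_side e_sym e_irr e_acyclic _ edge_ck)=> [[->]|[[j|//] /andP[jc jk] ij]]; first by left.
  have jW : j \in W by rewrite in_setD1 (jc : j \in scope c) andbT.
  by right; apply/bigcupP; exists j; rewrite // in_facs.
move=> H; apply/(in_side e_sym e_irr e_acyclic _ edge_ck).
case: H => [/eqP ->|/bigcupP[j jW]]; first by left.
rewrite in_facs => ij; right; exists (inl j) => //.
by rewrite W_neq // andbT; exact: W_scope.
Qed.

Lemma subtree_FV_split : subtree_fun (inr c) (inl k) =
  fun x => phi c x * \prod_(j in W) subtree_fun (inl j) (inr c) x.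
Proof.
apply/funext => x; rewrite /subtree_fun facs_FV_split big_setU1 /=; last first.
  apply/negP => /bigcupP[j jW]; rewrite in_facs => cj.
  have jc : e (inl j) (inr c) by exact: W_scope.
  by have := side_excl e_irr jc; rewrite cj.
congr (_ * _); apply: prod_bigcup => j j' i jW j'W; rewrite !in_facs => ij ij'.
have cj : e (inr c) (inl j) by exact: W_scope.
have cj' : e (inr c) (inl j') by exact: W_scope.
by have [] := side_disjoint e_sym e_irr e_acyclic cj cj' ij ij'.
Qed.

(** The derivatives in [U] are taken first: [phi c] does not depend on these variables, and applied
    to the branches they produce the incoming mu. Those in [W] remain. *)
Lemma pd_subtree_FV :
  pd_set (subtree_fun (inr c) (inl k)) (vars (inr c) (inl k)) =
  pd_set (fun x => phi c x * M x) W.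
Proof.
have WU : [disjoint W & U].
  by rewrite disjoint_sym (disjointWr (subsetDl _ _)) // U_scope_disjoint.
rewrite vars_FV_split (@pd_setU _ _ _ _ [set: 'I_K]%SET) ?subsetT //; last exact: regular_subtree.
(* Writing [U] as a union with the empty set assigns no derivative to [phi c]. *)
congr (pd_set _ W); rewrite subtree_FV_split -[U]set0U.
rewrite (@pd_set_mul_separate _ _ _ _ _ [set: 'I_K]%SET _ _ (scope c) [set: 'I_K]%SET) ?subsetT //.
- apply/funext => x; rewrite pd_set_empty; congr (_ * _).
  rewrite (@pd_set_bigcup _ _ _ _ _ _ _ (fun j => vars (inl j) (inr c)) [set: 'I_K]%SET).
  + by apply: eq_bigr => j jW; rewrite mu_children.
  + move=> j jW; split; rewrite ?subsetT ?subsetDl //; first exact: regular_subtree.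
    by apply: local_subtree_VF; exact: W_scope.
  + move=> i j iW jW ij; apply: (disjointWl (subsetDl _ _)).
    by apply: vars_VF_disjoint; rewrite ?W_scope.
- exact: regular_phi.
- by apply: regular_prod => j _; exact: regular_subtree.
- exact: local_setT.
- by rewrite -setI_eq0 set0I.
- exact: U_scope_disjoint.
- by rewrite -setI_eq0 set0I.
Qed.

(** The variables already differentiated in the message lie outside [scope c], so no variable is
    differentiated twice. *)
Lemma regular_mu j : j \in W -> pd_regular (muVF j c) (scope c).
Proof.
move=> jW; rewrite mu_children //.
apply: (regular_sub _ (@regular_pd_set _ _ _ _ [set: 'I_K]%SET _ (regular_subtree _ _ _) (subsetT _))).
apply/subsetP => i ic; rewrite in_setD in_setT andbT in_setD1; apply/negP => /andP[ij iv].
by rewrite (vars_scope jW iv ic) eqxx in ij.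
Qed.

Lemma local_mu j : j \in W -> local_on (muVF j c) (vars (inl j) (inr c)).
Proof.
by move=> jW; rewrite mu_children //; apply: local_pd_set; apply: local_subtree_VF; exact: W_scope.
Qed.

Lemma regular_M : pd_regular M (scope c).
Proof. by apply: regular_prod => j; exact: regular_mu. Qed.

Lemma local_M : local_on M (vars (inr c) (inl k)).
Proof.
apply: local_prod => j jW; apply: local_sub (local_mu jW).
rewrite vars_FV_split; apply/subsetP => i iv; rewrite in_setU.
have [->|ij] := eqVneq i j; first by rewrite jW.
by apply/orP; right; apply/bigcupP; exists j => //; rewrite in_setD1 ij.
Qed.

(** Among the variables in [W], the message from j depends on x_j only, so each derivative meets a
    single factor and turns its mu into lambda. *)
Lemma pd_M (t : {set 'I_K}) x : t \subset W ->
  pd_set M t x = (\prod_(j in W :\: t) muVF j c x) * \prod_(j in t) lamVF j c x.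
Proof.
move=> tW; pose A j : {set 'I_K} := if j \in t then [set j] else set0.
have {1}-> : t = \bigcup_(j in W) A j.
  apply/setP => i; apply/idP/bigcupP => [it|[j jW]]; rewrite /A.
    by exists i; [exact: (subsetP tW)|rewrite it set11].
  by case: ifP => [jt /set1P -> //|_]; rewrite in_set0.
rewrite (@pd_set_bigcup _ _ _ _ _ _ _ (fun j => vars (inl j) (inr c)) (scope c)).
- rewrite (big_setID t) (setIidPr tW) /= mulrC; congr (_ * _).
    by apply: eq_bigr => j; rewrite in_setD /A => /andP[/negPf -> _]; rewrite pd_set_empty.
  by apply: eq_bigr => j jt; rewrite /A jt pd_set1 lam_children // (subsetP tW).
- move=> j jW; split.
  + exact: regular_mu.
  + by rewrite /A; case: ifP => _; rewrite ?sub0set // sub1set W_scope.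
  + by rewrite /A; case: ifP => _; rewrite ?sub0set // sub1set self_var.
  + exact: local_mu.
- move=> i j iW jW ij; apply: (@disjointWl _ _ (vars (inl i) (inr c))).
    by rewrite /A; case: ifP => _; rewrite ?sub0set // sub1set self_var.
  by apply: vars_VF_disjoint; rewrite ?W_scope.
Qed.

Let kW : k \notin W.
Proof. by rewrite in_setD1 eqxx. Qed.

Let kWE : k |: W = scope c.
Proof. exact: setD1K. Qed.

Lemma pd_subtree_FV_sum x :
  pd_set (subtree_fun (inr c) (inl k)) (vars (inr c) (inl k)) x =
  \sum_(st | splits scope c k st)
    pd_set (phi c) st.1 (lower_in st.2 x) *
    \prod_(j in st.1) muVF j c x * \prod_(j in st.2) lamVF j c x.
Proof.
rewrite pd_subtree_FV (pd_set_mul (regular_phi c _) regular_M) ?subsetDl //.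
rewrite (sum_splits _ _ (fun s t => pd_set (phi c) s (lower_in t x) *
    \prod_(j in s) muVF j c x * \prod_(j in t) lamVF j c x)).
by apply: eq_bigr => t tW; rewrite pd_M // mulrA.
Qed.

Lemma pd_pd_subtree_FV_sum x :
  pd (pd_set (subtree_fun (inr c) (inl k)) (vars (inr c) (inl k))) k x =
  \sum_(st | splits scope c k st)
    pd_set (phi c) (k |: st.1) (lower_in st.2 x) *
    \prod_(j in st.1) muVF j c x * \prod_(j in st.2) lamVF j c x.
Proof.
rewrite pd_subtree_FV (pd_set_mul (regular_phi c _) regular_M) ?subsetDl //.
rewrite (pd_leibniz (regular_phi c _) regular_M) ?kWE // -kWE.
rewrite (sum_splits _ _ (fun s t => pd_set (phi c) (k |: s) (lower_in t x) *
    \prod_(j in s) muVF j c x * \prod_(j in t) lamVF j c x)).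
rewrite /leibniz sum_subset_setU1 //; apply: eq_bigr => t tW.
(* No incoming message depends on x_k, so the terms in which k falls on [M] vanish. *)
rewrite (@pd_set0 _ _ kind _ (k |: t) _ local_M) ?mulr0 ?addr0; last first.
  by apply/subsetPn; exists k; rewrite ?setU11 // vars_FV_excl.
rewrite pd_M // mulrA; congr (pd_set _ _ _ * _ * _).
have kt : k \notin t by apply: contra kW; exact: (subsetP tW).
apply/setP => i; rewrite in_setD !in_setU1 [in RHS]in_setD.
by have [->|_] := eqVneq i k; rewrite ?kt.
Qed.

End FactorStep.

(** * Branches at a variable node and at the root *)

Lemma vars_VF_split k c : k \in scope c ->
  vars (inl k) (inr c) :\ k = \bigcup_(c' in nbr scope k :\ c) vars (inr c') (inl k).
Proof.
move=> kc; have edge : e (inl k) (inr c) by [].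
apply/setP => i; rewrite in_setD1 in_vars; apply/andP/bigcupP.
  case=> ik /(in_side e_sym e_irr e_acyclic _ edge)[[ki]|[[//|c'] /andP[kc' c'c] ij]].
    by rewrite ki eqxx in ik.
  exists c'; rewrite ?in_vars // in_setD1 in_set (kc' : k \in scope c') andbT.
  exact: c'c.
case=> c'; rewrite in_setD1 in_set => /andP[c'c kc'] ic'; split.
  by apply: contraTneq ic' => ->; exact: vars_FV_excl.
apply/(in_side e_sym e_irr e_acyclic _ edge); right; exists (inr c'); rewrite -?in_vars //.
by rewrite (kc' : e (inl k) (inr c')).
Qed.

Lemma facs_VF_split k c : k \in scope c ->
  facs (inl k) (inr c) = \bigcup_(c' in nbr scope k :\ c) facs (inr c') (inl k).
Proof.
move=> kc; have edge : e (inl k) (inr c) by [].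
apply/setP => i; rewrite in_facs; apply/idP/bigcupP.
  case/(in_side e_sym e_irr e_acyclic _ edge)=> [//|[[//|c'] /andP[kc' c'c] ij]].
  exists c'; rewrite ?in_facs // in_setD1 in_set (kc' : k \in scope c') andbT.
  exact: c'c.
case=> c'; rewrite in_setD1 in_set => /andP[c'c kc'] ic'.
apply/(in_side e_sym e_irr e_acyclic _ edge); right; exists (inr c'); rewrite -?in_facs //.
by rewrite (kc' : e (inl k) (inr c')).
Qed.

(** Connectedness of the tree places every vertex other than r in a branch at r. *)
Lemma vars_root : [set: 'I_K]%SET :\ r = \bigcup_(c in nbr scope r) vars (inr c) (inl r).
Proof.
apply/setP => i; rewrite in_setD1 in_setT andbT; apply/idP/bigcupP => [ir|[c]].
  have [|[E]|[[//|c] rc ic]] := @connect_side _ e (inl r) e (inl i) _ (tree.1 _ _).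
  - by [].
  - by rewrite E eqxx in ir.
  by exists c; rewrite ?in_vars // in_set.
by rewrite in_set => rc; apply: contraTneq => ->; exact: vars_FV_excl.
Qed.

Lemma facs_root : \bigcup_(c in nbr scope r) facs (inr c) (inl r) = [set: C]%SET.
Proof.
apply/setP => i; rewrite in_setT; apply/bigcupP.
have [|//|[[//|c] rc ic]] := @connect_side _ e (inl r) e (inr i) _ (tree.1 _ _); first by [].
by exists c; rewrite ?in_facs // in_set.
Qed.

(** * Induction from the leaves to the root *)

Definition message_FV c k :=
  muFV c k = pd_set (subtree_fun (inr c) (inl k)) (vars (inr c) (inl k)) /\
  lamFV c k = pd (muFV c k) k.

(** The sender k belongs to its own component and has to be removed; in [message_FV] the variable k
    is the receiver and lies outside the component. *)
Definition message_VF k c :=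
  muVF k c = pd_set (subtree_fun (inl k) (inr c)) (vars (inl k) (inr c) :\ k) /\
  lamVF k c = pd (muVF k c) k.

Lemma message_FV_derivable c k : k \in scope c -> message_FV c k ->
  pd_derivable kind (muFV c k) k.
Proof.
move=> kc [-> _]; apply: (pd_derivable_set (regular_subtree _ _ [set: 'I_K]%SET)).
  exact: subsetT.
exact: vars_FV_excl.
Qed.

Lemma message_FV_step c k : rootward e (inl r) (inr c) (inl k) ->
  (forall j, j \in scope c :\ k -> message_VF j c) -> message_FV c k.
Proof.
move=> rw children; have kc : k \in scope c by have := rootward_edge rw.
have muE j (jW : j \in scope c :\ k) := (children j jW).1.
have lamE j (jW : j \in scope c :\ k) := (children j jW).2.
(* A leaf function has no variable besides k: the product of incoming messages is empty and no
   derivative is taken. *)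
have [c1|c1] := eqVneq #|scope c| 1%N.
  have W0 : scope c :\ k = set0.
    apply/eqP; rewrite -cards_eq0; have := cardsD1 k (scope c).
    by rewrite kc c1 add1n => -[<-].
  have leaf := dsp_leaf_fun messages c1 rw.
  have mu : muFV c k = phi c by apply/funext => x; have [] := leaf x.
  split; last by apply/funext => x; rewrite mu; have [] := leaf x.
  rewrite (pd_subtree_FV kc muE) W0 pd_set_empty mu.
  by apply/funext => x; rewrite big_set0 mulr1.
move/eqP in c1; have mu : muFV c k =
    pd_set (subtree_fun (inr c) (inl k)) (vars (inr c) (inl k)).
  apply/funext => x.
  by rewrite (dsp_fun_mu messages c1 rw) (pd_subtree_FV_sum kc muE lamE).
split=> //; apply/funext => x.
by rewrite mu (dsp_fun_lam messages c1 rw) (pd_pd_subtree_FV_sum kc muE lamE).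
Qed.

Lemma message_VF_step k c : rootward e (inl r) (inl k) (inr c) ->
  (forall c', c' \in nbr scope k :\ c -> message_FV c' k) -> message_VF k c.
Proof.
move=> rw children; have kc : k \in scope c by have := rootward_edge rw.
have cN : c \in nbr scope k by rewrite in_set.
rewrite /message_VF vars_VF_split // /subtree_fun facs_VF_split //.
(* The branch of a leaf variable contains no function: the product is 1 and its derivative 0, in
   agreement with [dsp_leaf_var]. *)
have [c1|c1] := eqVneq #|nbr scope k| 1%N.
  have A0 : nbr scope k :\ c = set0.
    apply/eqP; rewrite -cards_eq0; have := cardsD1 c (nbr scope k).
    by rewrite cN c1 add1n => -[<-].
  have leaf := dsp_leaf_var messages c1 rw.
  rewrite A0 !big_set0 pd_set_empty.
  have mu : muVF k c = fun=> 1 by apply/funext => x; have [] := leaf x.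
  split; first by rewrite mu; apply/funext => x; rewrite big_set0.
  by rewrite mu pd_cst; apply/funext => x; have [] := leaf x.
move/eqP in c1; have AN : nbr scope k :\ c \subset nbr scope k by exact: subsetDl.
have mu : muVF k c = var_mu muFV k (nbr scope k :\ c).
  by apply/funext => x; have [] := dsp_var messages c1 rw x.
split; first by rewrite mu var_mu_subtrees // => c' /children[].
rewrite mu -var_lam_pd //.
  by apply/funext => x; have [] := dsp_var messages c1 rw x.
move=> c' c'A; split; last by have [] := children c' c'A.
by apply: message_FV_derivable (children c' c'A); have := subsetP AN c' c'A; rewrite in_set.
Qed.

(** Both kinds of message are treated together, as each is built from the other kind; the size of
    the sender's component drops with every step away from the root. *)
Lemma messages_correct n :
  (forall c k, rootward e (inl r) (inr c) (inl k) ->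
     (#|side e (inr c) (inl k)| < n)%N -> message_FV c k) /\
  (forall k c, rootward e (inl r) (inl k) (inr c) ->
     (#|side e (inl k) (inr c)| < n)%N -> message_VF k c).
Proof.
elim: n => [|n [IHF IHV]]; first by split.
split=> [c k rw|k c rw] sn.
  apply: message_FV_step => // j; rewrite in_setD1 => /andP[jk jc].
  have cj : e (inr c) (inl j) by [].
  have jk' : inl j != inl k :> 'I_K + C by [].
  apply: IHV; first exact: (rootward_child e_sym e_irr e_acyclic rw).
  exact: leq_trans (side_proper e_sym e_irr e_acyclic (rootward_edge rw) cj jk') sn.
apply: message_VF_step => // c'; rewrite in_setD1 in_set => /andP[c'c kc'].
have kc'' : e (inl k) (inr c') by [].
have c'c' : inr c' != inr c :> 'I_K + C by [].
apply: IHF; first exact: (rootward_child e_sym e_irr e_acyclic rw).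
exact: leq_trans (side_proper e_sym e_irr e_acyclic (rootward_edge rw) kc'' c'c') sn.
Qed.

(** The root acts as a variable node with no function excluded: its branches contain all functions
    and all variables but r, and the last derivative, in x_r, turns mu into lambda. *)
Lemma root_lam_correct :
  pd_set (cdn phi) [set: 'I_K]%SET = root_lam kind scope muFV lamFV r.
Proof.
have msg c : c \in nbr scope r -> message_FV c r.
  rewrite in_set => rc; apply: (messages_correct _).1 (ltnSn _).
  exact: rootward_root.
rewrite /root_lam var_lam_pd //; last first.
  move=> c cN; split; last by have [] := msg c cN.
  by apply: message_FV_derivable (msg c cN); rewrite in_set in cN.
rewrite var_mu_subtrees // => [|c /msg[] //].
rewrite -vars_root facs_root -[in LHS](setD1K (in_setT r)).
have -> : (fun x => \prod_(c in [set: C]%SET) phi c x) = cdn phi.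
  by apply/funext => x; apply: eq_bigl => c; rewrite in_setT.
rewrite (@pd_setU1 _ _ _ _ [set: 'I_K]%SET) ?subsetT ?in_setD1 ?eqxx //.
by apply: regular_prod => c _; exact: regular_phi.
Qed.

End Messages.

Theorem mainTheorem3
  (R : realType) (K : nat)
  (d : measure_display) (T : measurableType d) (Pr : probability T R)
  (X : 'I_K -> {RV Pr >-> R}) (kind : 'I_K -> vkind R)
  (C : finType) (scope : C -> {set 'I_K}) (phi : C -> 'rV[R]_K -> R)
  (r : 'I_K)
  (muVF lamVF : 'I_K -> C -> 'rV[R]_K -> R)
  (muFV lamFV : C -> 'I_K -> 'rV[R]_K -> R) :
  is_cdn kind scope phi ->
  joint_cdf_of_cdn X kind phi ->
  is_tree (factor_graph scope) ->
  dsp_messages kind scope phi muVF lamVF muFV lamFV r ->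
  forall x : 'rV[R]_K,
    joint_pdf X kind x = root_lam kind scope muFV lamFV r x.
Proof.
move=> cdnP [_ cdfE] tree messages x.
have cdf : joint_cdf X = cdn phi by apply/funext.
rewrite /joint_pdf cdf -(root_lam_correct _ _ tree messages) //.
  exact: cdn_local cdnP.
exact: cdn_regular cdnP.
Qed.
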